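(* Let $D$ be a digraph such that every proper induced subdigraph of $D$ satisfies the $\alpha$-property. If $\alpha(D) \geq \frac{|V(D)|}{2}$, then $D$ satisfies the $\alpha$-property.
   Context: All digraphs are finite, without loops and without multiple edges (a pair of opposite edges $uv$, $vu$ is allowed). Two vertices $u,v$ are adjacent if $uv$ or $vu$ is an edge. A stable set is a set of pairwise non-adjacent vertices; $\alpha(D)$ is the maximum cardinality of a stable set of $D$, and a maximum stable set is one of cardinality $\alpha(D)$. A path is a directed path with distinct vertices (a single vertex is a path). A path partition of $D$ is a collection $\mathcal{P}$ of paths of $D$ such that every vertex of $D$ belongs to exactly one path of $\mathcal{P}$. A stable set $S$ and a path partition $\mathcal{P}$ are orthogonal if $|V(P)\cap S|=1$ for every $P\in\mathcal{P}$; in that case $\mathcal{P}$ is called an $S$-path partition. A digraph $D$ satisfies the $\alpha$-property if for every maximum stable set $S$ of $D$ there exists an $S$-path partition of $D$. *)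

(* Defs.v *)
From mathcomp Require Import all_boot.
Set Implicit Arguments.
Unset Strict Implicit.
Unset Printing Implicit Defensive.

(* A finite digraph without multiple edges is a relation e on a finType T
   of vertices; the absence of loops is the separate hypothesis
   [irreflexive e]. *)

Section Digraph.
Variables (T : finType) (e : rel T).

Definition adjacent : rel T := [rel u v | e u v || e v u].

Definition stable (S : {set T}) : bool :=
  [forall u in S, forall v in S, ~~ adjacent u v].

Definition alpha : nat := \max_(S : {set T} | stable S) #|S|.

Definition maximum_stable (S : {set T}) : bool :=
  stable S && (#|S| == alpha).

Definition dipath (p : seq T) : bool :=
  if p is x :: q then path e x q && uniq p else false.

(* Repetitions in the list P are excluded by the counting condition, since
   paths are nonempty; hence P amounts to a set of paths. *)
Definition path_partition (P : seq (seq T)) : bool :=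
  all dipath P && [forall x : T, count (fun p => x \in p) P == 1].

Definition orthogonal (S : {set T}) (P : seq (seq T)) : bool :=
  all (fun p => #|[set x in p] :&: S| == 1) P.

Definition alpha_property : Prop :=
  forall S : {set T}, maximum_stable S ->
    exists P : seq (seq T), path_partition P /\ orthogonal S P.

Definition induced (W : {set T}) : rel {x : T | x \in W} :=
  [rel u v | e (val u) (val v)].

End Digraph.

Arguments induced {T} e W.

(* Main.v *)
Require Import Defs.
From mathcomp Require Import all_boot.
From mathcomp Require Import zify.

(** Let S be a maximum stable set, X its complement, and N(Y) the set of
    neighbours in S of a set Y of vertices of X.  If some nonempty Y has
    |N(Y)| <= |Y| and Y :|: N(Y) is not everything, take such a Y with
    |N(Y)| + |X :\: Y| least: S traces a maximum stable set both on Y :|: N(Y)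
    (by exchange with the rest of S) and on its complement (where Hall's
    condition holds), and path partitions of the two parts are put together.
    Otherwise Hall's condition holds with a surplus of one, and removing any
    edge between X and S leaves a subdigraph on which S traces a maximum stable
    set. *)

Set Implicit Arguments.
Unset Strict Implicit.
Unset Printing Implicit Defensive.

Section Stable.
Variables (T : finType) (e : rel T).
Implicit Types S : {set T}.

Lemma stableP S :
  reflect {in S &, forall u v, ~~ adjacent e u v} (stable e S).
Proof.
apply: (iffP forall_inP) => [h u v uS vS | h u uS].
  by move/forall_inP: (h u uS); apply.
by apply/forall_inP => v vS; apply: h.
Qed.

Lemma adjacent_sym (x y : T) : adjacent e x y = adjacent e y x.
Proof. exact: orbC. Qed.

Lemma stable_leq_alpha S : stable e S -> #|S| <= alpha e.
Proof. exact: (@leq_bigmax_cond _ (stable e) (fun A : {set T} => #|A|)). Qed.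

End Stable.

(** * Path partitions of vertex subsets, orthogonal to [S] *)

Section OrthogonalCover.
Variables (T : finType) (e : rel T).
Implicit Types (S W Y I : {set T}) (x y : T).

(** An [S]-path partition of the subdigraph induced on [W], with paths kept in [T] so that
    partitions of disjoint sets can be concatenated. The boolean on the right of the count is read
    as 0 or 1, so no path leaves [W]. *)
Definition orthogonal_cover S W (P : seq (seq T)) :=
  [/\ all (dipath e) P, forall x, count (fun p => x \in p) P = (x \in W)
    & orthogonal S P].

Lemma orthogonal_coverU S W W' P P' :
  [disjoint W & W'] -> orthogonal_cover S W P -> orthogonal_cover S W' P' ->
  orthogonal_cover S (W :|: W') (P ++ P').
Proof.
move=> dis [dP cP oP] [dP' cP' oP']; split.
- by rewrite all_cat dP.
- move=> x; rewrite count_cat cP cP' in_setU.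
  by case: (boolP (x \in W)) => // /(disjointFr dis) ->.
- by rewrite /orthogonal all_cat; apply/andP.
Qed.

Lemma orthogonal_cover_setT S P :
  orthogonal_cover S [set: T] P -> path_partition e P /\ orthogonal S P.
Proof.
case=> dP cP oP; split=> //; rewrite /path_partition dP /=.
by apply/forallP => x; rewrite cP in_setT.
Qed.

Lemma orthogonal_cover_self S :
  orthogonal_cover S S [seq [:: x] | x <- enum S].
Proof.
split.
- by rewrite all_map; apply/allP.
- move=> x; rewrite count_map -[in RHS]mem_enum -(count_uniq_mem _ (enum_uniq _)).
  by apply: eq_count => y /=; rewrite inE eq_sym.
- rewrite /orthogonal all_map; apply/allP => x; rewrite mem_enum /= => xS.
  suff -> : [set y in [:: x]] :&: S = [set x] by rewrite cards1.
  by apply/setP => y; rewrite !inE andb_idr // => /eqP ->.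
Qed.

Lemma orthogonal_cover_edge S x s :
  adjacent e x s -> x \notin S -> s \in S ->
  exists P, orthogonal_cover S [set x; s] P.
Proof.
move=> xs xS sS; have x_neq_s : x != s by apply: contraNneq xS => ->.
(* The order of the two vertices depends on the direction of the edge, but only the vertex set
   matters here. *)
have cover p : dipath e p -> p =i [set x; s] -> orthogonal_cover S [set x; s] [:: p].
  move=> dp ep; split=> [|y|]; rewrite /orthogonal /= ?dp ?andbT ?addn0 ?ep //.
  suff -> : [set y in p] :&: S = [set s] by rewrite cards1.
  apply/setP => y; rewrite !inE ep !inE.
  have [-> | _] := eqVneq y s; first by rewrite orbT.
  by rewrite orbF; apply: contraNF xS => /andP [/eqP <-].
case/orP: xs => [xs | sx].
  by exists [:: [:: x; s]]; apply: cover => [|y]; rewrite /= ?xs ?inE ?x_neq_s.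
exists [:: [:: s; x]]; apply: cover => [|y]; rewrite /= ?sx ?inE 1?orbC //.
by rewrite eq_sym x_neq_s.
Qed.

(** The last hypothesis makes the trace of [S] a maximum stable set of the induced subdigraph; the
    paths obtained there are mapped back to [T] by [val]. *)
Lemma orthogonal_cover_induced S W :
  alpha_property (induced e W) -> stable e S ->
  (forall I, stable e I -> I \subset W -> #|I| <= #|S :&: W|) ->
  exists P, orthogonal_cover S W P.
Proof.
move=> alphaW /stableP stS maxS.
pose S' : {set {x | x \in W}} := val @^-1: S.
have imS' : val @: S' = S :&: W.
  apply/setP => x; rewrite inE; apply/imsetP/andP => [[u uS ->]|[xS xW]].
    by rewrite inE in uS; split=> //; apply: valP.
  by exists (exist _ x xW); rewrite ?inE.
have cardS' : #|S'| = #|S :&: W| by rewrite -imS' card_imset //; apply: val_inj.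
have stS' : stable (induced e W) S'.
  by apply/stableP => u v; rewrite !inE; apply: stS.
have /alphaW [P [/andP [dP /forallP cP] oP]] : maximum_stable (induced e W) S'.
  rewrite /maximum_stable stS' eqn_leq stable_leq_alpha //=.
  apply/bigmax_leqP => I /stableP stI.
  rewrite cardS' -(card_imset _ val_inj); apply: maxS.
    by apply/stableP => _ _ /imsetP [u uI ->] /imsetP [v vI ->]; apply: stI.
  by apply/subsetP => _ /imsetP [u _ ->]; apply: valP.
exists (map (map val) P); split.
- rewrite all_map; apply: sub_all dP => -[|u p] //= /andP [pP uP].
  rewrite (mem_map val_inj) (map_inj_uniq val_inj) uP andbT.
  by apply: homo_path pP.
- move=> x; rewrite count_map; have [xW | xW] := boolP (x \in W).
    rewrite -[RHS](eqP (cP (exist _ x xW))); apply: eq_count => p /=.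
    by rewrite -[x]/(val (exist (fun x => x \in W) x xW)) mem_map //; apply: val_inj.
  rewrite -[RHS](count_pred0 P); apply: eq_count => p /=.
  by apply: contraNF xW => /mapP [u _ ->]; apply: valP.
- rewrite /orthogonal all_map; apply: sub_all oP => p /= /eqP <-.
  rewrite -(card_imset _ val_inj); apply/eqP; congr #|pred_of_set _|.
  apply/setP => x; rewrite !inE; apply/andP/imsetP => [[/mapP [u up ->] uS]|[u]].
    by exists u; rewrite ?inE ?up.
  by rewrite !inE => /andP [up uS] ->; split; [apply: map_f|].
Qed.

(** * Neighbours in [S], and sets on which the trace of [S] is maximum *)

Definition nbrs S Y : {set T} := [set s in S | [exists y in Y, adjacent e y s]].

Lemma nbrs_sub S Y : nbrs S Y \subset S.
Proof. by apply/subsetP => s; rewrite inE => /andP []. Qed.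

Lemma mem_nbrs S Y y s : s \in S -> y \in Y -> adjacent e y s -> s \in nbrs S Y.
Proof. by move=> sS yY ys; rewrite inE sS; apply/exists_inP; exists y. Qed.

Lemma nbrsU S Y Y' : nbrs S (Y :|: Y') = nbrs S Y :|: nbrs S Y'.
Proof.
apply/setP => s; rewrite !inE -andb_orr; congr (_ && _).
apply/exists_inP/orP => [[y]|[]/exists_inP[y yY ys]].
- by rewrite inE => /orP [] yY ys; [left|right]; apply/exists_inP; exists y.
- by exists y; rewrite // inE yY.
- by exists y; rewrite // inE yY orbT.
Qed.

(** Exchange [I :\: S] for its neighbours in [S :&: W]: there are at least as many of them, and none
    lies in [I] because [I] is stable. *)
Lemma stable_leq_Hall S W :
  (forall Y, Y \subset W :\: S -> #|Y| <= #|nbrs S Y :&: W|) ->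
  forall I, stable e I -> I \subset W -> #|I| <= #|S :&: W|.
Proof.
move=> hall I /stableP stI IW.
have hI := hall _ (setSD S IW).
have dis : [disjoint I :&: S & nbrs S (I :\: S) :&: W].
  rewrite -setI_eq0; apply/eqP/setP => s; rewrite !inE; apply/negP.
  case/andP=> /andP [sI _] /andP [/andP [_ /exists_inP [y yI ys]] _].
  by case/setDP: yI => yI _; have := stI _ _ yI sI; rewrite ys.
have sub : (I :&: S) :|: (nbrs S (I :\: S) :&: W) \subset S :&: W.
  by rewrite subUset setIC setIS // setSI // nbrs_sub.
have := subset_leq_card sub.
by rewrite cardsU (disjoint_setI0 dis) cards0 subn0 -(cardsID S I); lia.
Qed.

(** No vertex of [Y] has a neighbour in [S] outside [Y :|: nbrs S Y], so [I] together with the rest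
    of [S] is stable and has at most [#|S|] elements. *)
Lemma stable_leq_exchange S Y :
  maximum_stable e S ->
  forall I, stable e I -> I \subset Y :|: nbrs S Y ->
  #|I| <= #|S :&: (Y :|: nbrs S Y)|.
Proof.
case/andP=> /stableP stS /eqP cardS I /stableP stI IW.
set W := Y :|: _ in IW *.
have cross x s : x \in I -> s \in S :\: W -> ~~ adjacent e x s.
  move=> xI /setDP [sS sW]; have := subsetP IW _ xI.
  case/setUP=> [xY | xN]; last by apply: stS; rewrite // (subsetP (nbrs_sub S Y)).
  apply: contra sW => xs; apply/setUP; right; exact: mem_nbrs xs.
have /stable_leq_alpha : stable e (I :|: S :\: W).
  apply/stableP => u v /setUP [uI|uS] /setUP [vI|vS].
  - exact: stI.
  - exact: cross.
  - by rewrite adjacent_sym cross.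
  - by case/setDP: uS vS => uS _ /setDP [vS _]; apply: stS.
rewrite -cardS -(cardsID W S) cardsU.
suff -> : I :&: (S :\: W) = set0 by rewrite cards0; lia.
apply/setP => x; rewrite in_setI in_setD in_set0.
by apply/negP => /and3P [/(subsetP IW) ->].
Qed.

End OrthogonalCover.

Theorem theorem15 (T : finType) (e : rel T) (loopless : irreflexive e)
  (proper_alpha : forall W : {set T}, W \proper [set: T] ->
     alpha_property (induced e W))
  (half_alpha : #|T| <= 2 * alpha e) :
  alpha_property e.
Proof.
move=> S maxS; have /andP [stS /eqP cardS] := maxS.
suff [P /orthogonal_cover_setT PP] : exists P, orthogonal_cover e S [set: T] P.
  by exists P.
have cover_proper (W : {set T}) : W != [set: T] ->
    (forall I, stable e I -> I \subset W -> #|I| <= #|S :&: W|) ->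
    exists P, orthogonal_cover e S W P.
  move=> WT; apply: orthogonal_cover_induced stS.
  by apply: proper_alpha; rewrite properT.
have cover_split W : (exists P, orthogonal_cover e S W P) ->
    (exists P, orthogonal_cover e S (~: W) P) ->
    exists P, orthogonal_cover e S [set: T] P.
  move=> [P hP] [P' hP']; exists (P ++ P'); rewrite -(setUCr W).
  by apply: orthogonal_coverU hP hP'; rewrite -setI_eq0 setICr.
have card_compl : #|~: S| <= #|S| by have := cardsC S; lia.
pose N := nbrs e S.
pose deficient (Y : {set T}) :=
  [&& Y \subset ~: S, Y != set0, Y :|: N Y != [set: T] & #|N Y| <= #|Y|].
have [/existsP [Y0 defY0] | /existsPn noDef] := boolP [exists Y, deficient Y].
  (* Up to the constant [#|~: S|], the minimised quantity is [#|N Y| - #|Y|], written without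
     truncated subtraction. *)
  have [Y /and4P [YX Yn0 YT defY] minY] :=
    @arg_minnP _ Y0 deficient (fun Y => #|N Y| + #|~: S :\: Y|) defY0.
  apply: (cover_split (Y :|: N Y)).
    by apply: cover_proper YT _; apply: stable_leq_exchange.
  apply: cover_proper.
    apply: contra Yn0 => /eqP WT; rewrite -subset0 -setCT -WT setCK.
    exact: subsetUl.
  apply: stable_leq_Hall => Z ZW.
  have ZX : Z \subset ~: S :\: Y.
    apply/subsetP => z /(subsetP ZW) /setDP [].
    by rewrite !inE negb_or => /andP [-> _] ->.
  have YZX : Y :|: Z \subset ~: S.
    by rewrite subUset YX (subset_trans ZX) ?subsetDl.
  (* If [Y :|: Z] is not deficient, [#|~: S|] separates the two sides: the left is at most this
     since [#|N Y| <= #|Y|], the right at least this once [#|Y :|: Z| <= #|N (Y :|: Z)|]. *)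
  have leYZ : #|N Y| + #|~: S :\: Y| <= #|N (Y :|: Z)| + #|~: S :\: (Y :|: Z)|.
    have [/minY //|] := boolP (deficient (Y :|: Z)).
    have YZn0 : Y :|: Z != set0 by rewrite setU_eq0 negb_and Yn0.
    rewrite /deficient YZX YZn0 /= => ndef.
    suff : #|Y :|: Z| <= #|N (Y :|: Z)|.
      move: (cardsD (~: S) Y) (cardsD (~: S) (Y :|: Z)).
      rewrite (setIidPr YX) (setIidPr YZX).
      by move: (subset_leq_card YX) (subset_leq_card YZX); lia.
    move: ndef; rewrite negb_and negbK -ltnNge => /orP [/eqP WT | /ltnW //].
    (* When [Y :|: Z] and its neighbours exhaust the vertices, all of [S] lies in [N (Y :|: Z)], and
       [#|~: S| <= #|S|] concludes. *)
    apply: leq_trans (subset_leq_card YZX) (leq_trans card_compl _).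
    apply: subset_leq_card; apply/subsetP => s sS.
    have /setUP [/(subsetP YZX) | //] : s \in (Y :|: Z) :|: N (Y :|: Z).
      by rewrite WT.
    by rewrite inE sS.
  have subN : N Z :\: N Y \subset N Z :&: ~: (Y :|: N Y).
    apply/subsetP => s /setDP [sZ sY]; rewrite in_setI sZ in_setC in_setU negb_or sY.
    rewrite andbT; apply/negP => /(subsetP YX).
    by rewrite in_setC (subsetP (nbrs_sub _ _ _) _ sZ).
  apply: leq_trans (subset_leq_card subN).
  (* Adding [Z] to [Y] removes [#|Z|] from the second term and adds [#|N Z :\: N Y|] to the first,
     so [leYZ] yields Hall's condition for [Z]. *)
  move: leYZ; rewrite /N nbrsU -/(N Y) -/(N Z) -setDDl.
  move: (cardsD (~: S :\: Y) Z) (subset_leq_card ZX); rewrite (setIidPr ZX).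
  move: (cardsD (N Z) (N Y)) (subset_leq_card (subsetIl (N Z) (N Y))).
  by rewrite cardsU [N Y :&: _]setIC; lia.
have [X0 | [x xX]] := set_0Vmem (~: S).
  exists [seq [:: x] | x <- enum S].
  by rewrite -setC0 -X0 setCK; apply: orthogonal_cover_self.
have xS : x \notin S by rewrite inE in xX.
have xN Y : x \notin N Y by apply: contra xS; apply: (subsetP (nbrs_sub _ _ _)).
(* As [x] avoids both [Y] and [N Y], these do not cover everything, so only a strict inequality
   keeps [Y] from being deficient. *)
have surplus (Y : {set T}) : x \notin Y -> Y \subset ~: S -> Y != set0 -> #|Y| < #|N Y|.
  move=> xY YX Yn0; have := noDef Y.
  rewrite /deficient YX Yn0 /= negb_and negbK -ltnNge => /orP [/eqP WT | //].
  by have := in_setT x; rewrite -WT inE (negPf xY) (negPf (xN Y)).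
(* Without neighbours in [S], [[set x]] would be deficient: it is not the whole vertex set, since
   [S] is nonempty. *)
have [s sNx] : exists s, s \in N [set x].
  apply/set0Pn; apply/eqP => Nx0.
  have [s sS] : exists s, s \in S.
    apply/set0Pn; rewrite -card_gt0; apply: leq_trans card_compl.
    by apply/card_gt0P; exists x.
  have := noDef [set x].
  rewrite /deficient sub1set xX -card_gt0 cards1 Nx0 cards0 setU0 /= andbT negbK.
  move/eqP => xT; have := in_setT s; rewrite -xT inE => /eqP sx.
  by rewrite -sx sS in xS.
have [sS /exists_inP [_ /set1P -> xs]] : s \in S /\ [exists y in [set x], adjacent e y s].
  by apply/andP; rewrite inE in sNx.
apply: (cover_split [set x; s]); first exact: orthogonal_cover_edge.
apply: cover_proper.
  by apply/eqP => /setP /(_ x); rewrite !inE eqxx.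
apply: stable_leq_Hall => Y YW.
have [-> | Yn0] := eqVneq Y set0; first by rewrite cards0.
have xY : x \notin Y.
  by apply/negP => /(subsetP YW); rewrite !inE eqxx andbF.
have YX : Y \subset ~: S by apply: subset_trans YW _; rewrite setDE subsetIr.
(* Removing [s] costs [N Y] at most one element, which the surplus pays for. *)
have := surplus _ xY YX Yn0; rewrite (cardsD1 s (N Y)).
have /subset_leq_card : N Y :\ s \subset N Y :&: ~: [set x; s].
  apply/subsetP => y; rewrite in_setD1 => /andP [ys yN].
  rewrite in_setI yN !inE negb_or ys andbT.
  by apply: contraNneq (xN Y) => <-.
by rewrite -/(N Y); case: (s \in N Y); lia.
Qed.
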